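(* Let $N$ be a positive integer. As formal power series in $z$, $$\sum_{\substack{n\ge0\\ \pi\in C_N\wr S_n}}\frac{z^n}{[n]_q!}\,t^{\mathrm{exc}(\pi)}r^{\vec{\mathrm{fix}}(\pi)}s^{\vec{\mathrm{col}}(\pi)}q^{\mathrm{maj}(\pi)} =\frac{\exp_q(r_0z)(1-tq)\left(\prod_{m=1}^{N-1}\mathrm{Exp}_q(-s_mz)\exp_q(r_ms_mz)\right)}{\left(1+\sum_{m=1}^{N-1}s_m\right)\exp_q(tqz)-\left(tq+\sum_{m=1}^{N-1}s_m\right)\exp_q(z)}.$$
   Context: $[n]=\{1,\dots,n\}$; $[n]_q=1+q+\dots+q^{n-1}$, $[n]_q!=\prod_{j=1}^n[j]_q$; $\exp_q(z)=\sum_{i\ge0}z^i/[i]_q!$ and $\mathrm{Exp}_q(z)=\sum_{i\ge0}q^{\binom i2}z^i/[i]_q!$. For vectors, $r^{\vec\alpha}=r_0^{\alpha_0}\cdots r_{N-1}^{\alpha_{N-1}}$ and $s^{\vec\beta}=s_1^{\beta_1}\cdots s_{N-1}^{\beta_{N-1}}$. Colored permutations: an element $\pi\in C_N\wr S_n$ is a word $\pi=\pi_1\cdots\pi_n$ whose letters are $\pi_i=|\pi_i|^{\epsilon_i}$ with $|\pi_i|\in[n]$ and color $\epsilon_i\in\{0,\dots,N-1\}$, such that $|\pi_1|\cdots|\pi_n|$ is a permutation of $[n]$. Letters are totally ordered by $1^{N-1}<2^{N-1}<\dots<n^{N-1}<1^{N-2}<\dots<n^{N-2}<\dots<1^0<\dots<n^0$.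 Statistics: $\mathrm{DES}(\pi)=\{i\in[n-1]:\pi_i>\pi_{i+1}\}$, $\mathrm{maj}(\pi)=\sum_{i\in\mathrm{DES}(\pi)}i$; $\mathrm{exc}(\pi)=|\{i\in[n]:\pi_i>i^0\}|$; $\mathrm{fix}_k(\pi)=|\{i\in[n]:\pi_i=i^k\}|$ for $0\le k\le N-1$ and $\vec{\mathrm{fix}}(\pi)=(\mathrm{fix}_0(\pi),\dots,\mathrm{fix}_{N-1}(\pi))$; $\mathrm{col}_m(\pi)=|\{i\in[n]:\epsilon_i=m\}|$ for $1\le m\le N-1$ and $\vec{\mathrm{col}}(\pi)=(\mathrm{col}_1(\pi),\dots,\mathrm{col}_{N-1}(\pi))$. For $n=0$ there is only the empty word, all of whose statistics are zero. *)

(* Defs.v *)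
From HB Require Import structures.
From mathcomp Require Import all_boot all_order all_algebra all_fingroup.
From mathcomp Require Import boolp.

Set Implicit Arguments.
Unset Strict Implicit.
Unset Printing Implicit Defensive.

Import GRing.Theory.
Local Open Scope ring_scope.

(* [FPS f] is the formal power series \sum_n (f n) z^n.  A record rather than
   an alias of [nat -> R], so that [*] is the Cauchy product and never the
   pointwise one. *)
Record fps (R : Type) := FPS { fcoef : nat -> R }.

HB.instance Definition _ (R : Type) := gen_eqMixin (fps R).
HB.instance Definition _ (R : Type) := gen_choiceMixin (fps R).

Lemma fpsP (R : Type) (f g : fps R) : fcoef f =1 fcoef g <-> f = g.
Proof.
split=> [|-> //]; case: f => f; case: g => g /= fg.
by congr FPS; apply: funext.
Qed.

Section Zmodule.
Variable R : zmodType.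
Implicit Types f g : fps R.

Definition fps_zero : fps R := FPS (fun=> 0).
Definition fps_opp f := FPS (fun n => - fcoef f n).
Definition fps_add f g := FPS (fun n => fcoef f n + fcoef g n).

Fact fps_addA : associative fps_add.
Proof. by move=> f g h; apply/fpsP => n /=; rewrite addrA. Qed.
Fact fps_addC : commutative fps_add.
Proof. by move=> f g; apply/fpsP => n /=; rewrite addrC. Qed.
Fact fps_add0 : left_id fps_zero fps_add.
Proof. by move=> f; apply/fpsP => n /=; rewrite add0r. Qed.
Fact fps_addN : left_inverse fps_zero fps_opp fps_add.
Proof. by move=> f; apply/fpsP => n /=; rewrite addNr. Qed.

HB.instance Definition _ :=
  GRing.isZmodule.Build (fps R) fps_addA fps_addC fps_add0 fps_addN.

End Zmodule.

Section Ring.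
Variable R : comNzRingType.
Implicit Types f g : fps R.

Definition fpsC (c : R) : fps R := FPS (fun n => if n == 0%N then c else 0).
Definition fps_mul f g : fps R :=
  FPS (fun n => \sum_(i < n.+1) fcoef f i * fcoef g (n - i)%N).

(* The ring axioms are transported from polynomials by truncation. *)
Let tr n f : {poly R} := \poly_(i < n.+1) fcoef f i.

Let coef_tr n f i : (i <= n)%N -> (tr n f)`_i = fcoef f i.
Proof. by move=> le_in; rewrite coef_poly ltnS le_in. Qed.

Let fps_mulE n (p q : {poly R}) f g :
    (forall i, (i <= n)%N -> p`_i = fcoef f i) ->
    (forall i, (i <= n)%N -> q`_i = fcoef g i) ->
  forall i, (i <= n)%N -> (p * q)`_i = fcoef (fps_mul f g) i.
Proof.
move=> pf qg i le_in; rewrite coefM /=; apply: eq_bigr => j _.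
by rewrite pf ?qg ?(leq_trans (leq_subr _ _) le_in) //
           (leq_trans _ le_in) // -ltnS.
Qed.

Let tr_mul n f g i :
  (i <= n)%N -> (tr n f * tr n g)`_i = fcoef (fps_mul f g) i.
Proof. by apply: fps_mulE => j; apply: coef_tr. Qed.

Fact fps_mulA : associative fps_mul.
Proof.
move=> f g h; apply/fpsP => n.
rewrite -(@fps_mulE n (tr n f) (tr n g * tr n h)) //; last first.
- exact: tr_mul.
- exact: coef_tr.
rewrite -(@fps_mulE n (tr n f * tr n g) (tr n h)) ?mulrA //; last first.
- exact: coef_tr.
- exact: tr_mul.
Qed.

Fact fps_mulC : commutative fps_mul.
Proof. by move=> f g; apply/fpsP => n; rewrite -!(@tr_mul n) // mulrC. Qed.

Fact fps_mul1 : left_id (fpsC 1) fps_mul.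
Proof.
move=> f; apply/fpsP => n /=.
rewrite big_ord_recl /= mul1r subn0 big1 ?addr0 // => i _.
by rewrite mul0r.
Qed.

Fact fps_mulDl : left_distributive fps_mul (@fps_add R).
Proof.
move=> f g h; apply/fpsP => n /=; rewrite -big_split /=.
by apply: eq_bigr => i _; rewrite mulrDl.
Qed.

Fact fps_1_neq0 : fpsC 1 != 0.
Proof.
by apply/eqP => /fpsP /(_ 0%N) /= /eqP; rewrite oner_eq0.
Qed.

HB.instance Definition _ := GRing.Zmodule_isComNzRing.Build (fps R)
  fps_mulA fps_mulC fps_mul1 fps_mulDl fps_1_neq0.

(* f(z) |-> f(c z) *)
Definition dilate (c : R) f : fps R := FPS (fun n => c ^+ n * fcoef f n).

End Ring.

Section UnitRing.
Variable R : comUnitRingType.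
Implicit Types f g : fps R.

Definition fps_unit : pred (fps R) := fun f => fcoef f 0 \is a GRing.unit.

(* The first n + 1 coefficients of 1 / f, from
   f_0 g_(n+1) = - \sum_(i <= n) f_(n+1-i) g_i. *)
Fixpoint inv_coefs f n : seq R :=
  if n is m.+1 then
    let g := inv_coefs f m in
    rcons g (- (fcoef f 0)^-1 * \sum_(i < m.+1) fcoef f (m.+1 - i) * g`_i)
  else [:: (fcoef f 0)^-1].

(* As for every ring in the library, a non-invertible element is its own
   conventional inverse. *)
Definition fps_inv f : fps R :=
  if fps_unit f then FPS (fun n => (inv_coefs f n)`_n) else f.

Let size_inv_coefs f n : size (inv_coefs f n) = n.+1.
Proof. by elim: n => //= n IHn; rewrite size_rcons IHn. Qed.

Let nth_inv_coefs f n i : (i <= n)%N -> (inv_coefs f n)`_i = (inv_coefs f i)`_i.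
Proof.
elim: n => [|n IHn]; first by rewrite leqn0 => /eqP->.
rewrite leq_eqVlt => /predU1P[-> //|lt_in].
by rewrite /= nth_rcons size_inv_coefs lt_in IHn.
Qed.

Fact fps_mulV : {in fps_unit, left_inverse 1 fps_inv *%R}.
Proof.
move=> f Uf; have Uf0 : fcoef f 0 \is a GRing.unit by [].
rewrite /fps_inv [fps_unit f]Uf0; apply/fpsP => -[|n].
  by rewrite /= big_ord1 /= mulVr.
change (\sum_(i < n.+2) (inv_coefs f i)`_i * fcoef f (n.+1 - i) = 0).
rewrite big_ord_recr /= subnn nth_rcons size_inv_coefs ltnn eqxx.
rewrite mulrC mulrA mulrN divrr // mulN1r.
apply/eqP; rewrite subr_eq0; apply/eqP/eq_bigr => i _ /=.
by rewrite mulrC [in RHS](@nth_inv_coefs _ n i) ?leq_ord.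
Qed.

Fact fps_unitPl f g : g * f = 1 -> fps_unit f.
Proof.
move=> /fpsP /(_ 0%N) /=; rewrite big_ord1 /= => gf1.
by apply/unitrPr; exists (fcoef g 0); rewrite mulrC.
Qed.

Fact fps_inv_out : {in [predC fps_unit], fps_inv =1 id}.
Proof. by move=> f /negbTE Uf; rewrite /fps_inv [fps_unit f]Uf. Qed.

HB.instance Definition _ := GRing.ComNzRing_hasMulInverse.Build (fps R)
  fps_mulV fps_unitPl fps_inv_out.

End UnitRing.

Section QSeries.
Variables (F : fieldType) (q : F).

Definition qint (n : nat) : F := \sum_(i < n) q ^+ i.
Definition qfact (n : nat) : F := \prod_(1 <= j < n.+1) qint j.

Definition expq : fps F := FPS (fun i => (qfact i)^-1).
Definition Expq : fps F := FPS (fun i => q ^+ 'C(i, 2) / qfact i).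

End QSeries.

(* A colored permutation of {1, ..., n} is the pair of |pi| and of the word of
   colors, where pi.2 i is the color of the letter in position i (not of the
   letter with absolute value i).  The element i of 'I_n stands for i + 1, both
   as a position and as an absolute value. *)
Definition colperm (N n : nat) : finType := ('S_n * {ffun 'I_n -> 'I_N})%type.

(* (a, c) is the letter a^c, with a >= 1. *)
Definition letter := (nat * nat)%type.

Definition ltl (x y : letter) : bool :=
  (y.2 < x.2)%N || (x.2 == y.2) && (x.1 < y.1)%N.

Section Statistics.
Variables (N n : nat) (pi : colperm N n).

Definition letter_at (i : 'I_n) : letter := ((pi.1 i).+1, val (pi.2 i)).

Definition DES : {set 'I_n} :=
  [set i : 'I_n | [exists j : 'I_n,
     (j == i.+1 :> nat) && ltl (letter_at j) (letter_at i)]].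
Definition maj : nat := \sum_(i in DES) i.+1.
Definition exc : nat := #|[set i : 'I_n | ltl (i.+1, 0%N) (letter_at i)]|.
Definition fixk (k : nat) : nat :=
  #|[set i : 'I_n | letter_at i == (i.+1, k)]|.
Definition colm (m : nat) : nat := #|[set i : 'I_n | (letter_at i).2 == m]|.

End Statistics.

(* Main.v *)
Require Import Defs.
From HB Require Import structures.
From mathcomp Require Import all_boot all_order all_algebra all_fingroup.
From mathcomp Require Import ring zify.

(* By MacMahon's Verfahren, q^maj(pi) / [n]_q! is, up to a power of 1 - q, the
   generating function by sum of the weakly decreasing sequences of n parts that
   decrease strictly at the descents of pi.  On the positions of the part 0, pi
   consists of one increasing run for each color, the color 0 coming last.  To be
   able to remove these runs one at a time, consider more generally the colored
   injective words of length n over n + m values and their generating function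
   P_m(z).

   Key fact (peel): let p be an injective word of length n, and let an increasing
   run of l letters of one color be appended to p, m values remaining unused.
   Beyond the n-th value that is not appended, all letters of p exceed their
   positions, however many values are appended there, so that the appended letters
   can be inserted freely into m + 1 gaps: in the first gap they are fixed points, in the
   other ones they exceed their position.  If a, f, e are the weights of an
   appended letter that is smaller than, equal to, or greater than its position,
   this gives
     (1 - f z) (1 - e z)^m P_m(z) = (1 - a z)^(m+1) \sum_l 'C(m+l, l) (a z)^l P'_(m+l)(z)
   where P' is the generating function without this run (and a, f, e are scaled
   by 1 - q).  After the runs of all colors have been removed, P_m(q z) is left.
   The resulting linear system has a unique solution when no 1 - q^n is a zero
   divisor, and it is solved by P_m = K F^(m+1) rho^m for explicit series K, F,
   rho; the theorem is the case m = 0. *)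

Set Implicit Arguments.
Unset Strict Implicit.
Unset Printing Implicit Defensive.

Import GRing.Theory.
Local Open Scope ring_scope.

(** * Formal power series *)

Section Fps.
Variable R : comNzRingType.
Implicit Types (f g : fps R) (v : nat -> fps R).

Lemma fcoefD f g n : fcoef (f + g) n = fcoef f n + fcoef g n.
Proof. by []. Qed.

Lemma fcoefN f n : fcoef (- f) n = - fcoef f n.
Proof. by []. Qed.

Lemma fcoef0 n : fcoef (0 : fps R) n = 0.
Proof. by []. Qed.

Lemma fcoef1 n : fcoef (1 : fps R) n = (n == 0%N)%:R.
Proof. by rewrite /=; case: eqP. Qed.

Lemma fcoefM f g n : fcoef (f * g) n = \sum_(i < n.+1) fcoef f i * fcoef g (n - i).
Proof. by []. Qed.

Lemma fcoefM0 f g : fcoef (f * g) 0 = fcoef f 0 * fcoef g 0.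
Proof. by rewrite fcoefM big_ord1. Qed.

Lemma fcoef_prod0 (I : Type) (s : seq I) (P : pred I) (F : I -> fps R) :
  fcoef (\prod_(i <- s | P i) F i) 0 = \prod_(i <- s | P i) fcoef (F i) 0.
Proof. exact: (big_morph (fun f => fcoef f 0) fcoefM0). Qed.

Lemma fcoefX0 f n : fcoef (f ^+ n) 0 = fcoef f 0 ^+ n.
Proof. by elim: n => // n IHn; rewrite !exprS fcoefM0 IHn. Qed.

Lemma fcoefCM (c : R) f n : fcoef (fpsC c * f) n = c * fcoef f n.
Proof.
rewrite fcoefM big_ord_recl /= subn0 big1 ?addr0 // => i _.
by rewrite mul0r.
Qed.

Fact fpsC_is_additive : zmod_morphism (@fpsC R).
Proof. by move=> c d; apply/fpsP => -[|n] //=; rewrite subr0. Qed.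
Fact fpsC_is_multiplicative : monoid_morphism (@fpsC R).
Proof.
split=> // c d; apply/fpsP => n; rewrite fcoefCM /=.
by case: eqP; rewrite ?mulr0.
Qed.
HB.instance Definition _ :=
  GRing.isZmodMorphism.Build R (fps R) (@fpsC R) fpsC_is_additive.
HB.instance Definition _ :=
  GRing.isMonoidMorphism.Build R (fps R) (@fpsC R) fpsC_is_multiplicative.

Fact dilate_is_additive (c : R) : zmod_morphism (dilate c).
Proof. by move=> f g; apply/fpsP => n /=; rewrite mulrBr. Qed.
Fact dilate_is_multiplicative (c : R) : monoid_morphism (dilate c).
Proof.
split=> [|f g]; apply/fpsP => n.
  by case: n => [|n] /=; rewrite ?mulr1 ?mulr0.
rewrite /= mulr_sumr; apply: eq_bigr => i _.
by rewrite mulrACA -exprD subnKC // -ltnS.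
Qed.
HB.instance Definition _ (c : R) :=
  GRing.isZmodMorphism.Build (fps R) (fps R) (dilate c) (dilate_is_additive c).
HB.instance Definition _ (c : R) :=
  GRing.isMonoidMorphism.Build (fps R) (fps R) (dilate c)
    (dilate_is_multiplicative c).

Lemma dilateC (c d : R) : dilate c (fpsC d) = fpsC d.
Proof. by apply/fpsP => -[|n] /=; rewrite ?mul1r ?mulr0. Qed.

Lemma dilate_comp (c d : R) f : dilate c (dilate d f) = dilate (c * d) f.
Proof. by apply/fpsP => n /=; rewrite exprMn mulrA. Qed.

Definition fpsX : fps R := FPS (fun n => (n == 1%N)%:R).

Lemma fcoefXM f n :
  fcoef (fpsX * f) n = if n is k.+1 then fcoef f k else 0.
Proof.
rewrite fcoefM; case: n => [|n]; first by rewrite big_ord1 mul0r.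
rewrite !big_ord_recl /= mul0r add0r mul1r subSS subn0 big1 ?addr0 // => i _.
by rewrite mul0r.
Qed.

Definition lin (c : R) : fps R := 1 - fpsC c * fpsX.

Lemma fcoef_linM c f n : fcoef (lin c * f) n =
  fcoef f n - (if n is k.+1 then c * fcoef f k else 0).
Proof.
rewrite /lin mulrBl mul1r -mulrA fcoefD fcoefN fcoefCM fcoefXM.
by case: n => //; rewrite mulr0.
Qed.

Lemma fcoef_lin0 c : fcoef (lin c) 0 = 1.
Proof. by rewrite -[lin c]mulr1 fcoef_linM subr0. Qed.

(* zsum v is the locally finite sum \sum_i z^i v_i *)
Definition zsum v : fps R :=
  FPS (fun n => \sum_(i < n.+1) fcoef (v i) (n - i)).

Lemma fcoef_zsum v n : fcoef (zsum v) n = \sum_(i < n.+1) fcoef (v i) (n - i).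
Proof. by []. Qed.

Lemma eq_zsum v w : v =1 w -> zsum v = zsum w.
Proof. by move=> vw; apply/fpsP => n; apply: eq_bigr => i _; rewrite vw. Qed.

Lemma zsum_recl v : zsum v = v 0%N + fpsX * zsum (fun i => v i.+1).
Proof.
apply/fpsP => -[|n]; rewrite fcoefD fcoefXM.
  by rewrite /= big_ord1 addr0.
by rewrite /= big_ord_recl subn0; congr (_ + _).
Qed.

Lemma zsumD v w : zsum (fun i => v i + w i) = zsum v + zsum w.
Proof. by apply/fpsP => n; rewrite /= -big_split. Qed.

Lemma zsumB v w : zsum (fun i => v i - w i) = zsum v - zsum w.
Proof. by apply/fpsP => n; rewrite /= -sumrB. Qed.

Lemma zsumM f v : zsum (fun i => f * v i) = f * zsum v.
Proof.
apply/fpsP => n; elim: n v => [|n IHn] v.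
  by rewrite fcoefM0 /= !big_ord1.
rewrite zsum_recl (zsum_recl v) mulrDr !fcoefD mulrCA !fcoefXM.
by rewrite IHn.
Qed.

Lemma zsum_flip (B : nat -> nat -> R) :
  zsum (fun i => FPS (B i)) = zsum (fun j => FPS (fun i => B i j)).
Proof.
apply/fpsP => n; rewrite /= (reindex_inj rev_ord_inj) /=.
by apply: eq_bigr => i _; rewrite subSS subKn // -ltnS.
Qed.

Lemma zsum_geometric g : (1 - fpsX * g) * zsum (fun l => g ^+ l) = 1.
Proof.
have E : zsum (fun l => g ^+ l) = 1 + fpsX * (g * zsum (fun l => g ^+ l)).
  rewrite [LHS]zsum_recl expr0 -(zsumM g); congr (1 + fpsX * _).
  by apply: eq_zsum => l; rewrite exprS.
by rewrite mulrBl mul1r {1}E -mulrA addrK.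
Qed.

(** Negative binomial series: by Pascal's rule, the sums s_m satisfy s_(m+1) = s_m + z g s_(m+1), so
    that each factor 1 - z g lowers m by one. *)
Lemma zsum_binomial g m :
  (1 - fpsX * g) ^+ m.+1 * zsum (fun l => g ^+ l *+ 'C(m + l, l)) = 1.
Proof.
elim: m => [|m IHm].
  by rewrite expr1 -[RHS](zsum_geometric g); under eq_zsum do rewrite add0n binn.
pose s k := zsum (fun l => g ^+ l *+ 'C(k + l, l)).
suff E : s m.+1 = s m + fpsX * (g * s m.+1).
  rewrite exprSr -mulrA -[X in _ * X]/((1 - fpsX * g) * s m.+1) mulrBl mul1r.
  by rewrite {1}E [X in _ + X - _]mulrA addrK.
rewrite {1}/s zsum_recl /s [in RHS]zsum_recl /= !addn0 !bin0 -addrA.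
congr (_ + _); rewrite -mulrDr -(zsumM g) -zsumD; congr (_ * _).
apply: eq_zsum => l.
by rewrite addnS binS addSn mulrnDr exprS mulrnAr addnS.
Qed.

End Fps.

Arguments fpsX {R}.

Section FpsUnit.
Variable R : comUnitRingType.
Implicit Types f g : fps R.

Lemma fps_unitE f : (f \is a GRing.unit) = (fcoef f 0 \is a GRing.unit).
Proof. by []. Qed.

Lemma fps_unit1 f : fcoef f 0 = 1 -> f \is a GRing.unit.
Proof. by rewrite fps_unitE => ->; apply: unitr1. Qed.

Lemma fcoefV0 f : f \is a GRing.unit -> fcoef f^-1 0 = (fcoef f 0)^-1.
Proof.
move=> Uf; have := fcoefM0 f f^-1; rewrite divrr // fcoef1 => E.
by rewrite -[LHS]mul1r -(mulVr (x := fcoef f 0)) // -mulrA -E mulr1.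
Qed.

Lemma lin_unit (c : R) : lin c \is a GRing.unit.
Proof. by apply: fps_unit1; rewrite fcoef_lin0. Qed.

End FpsUnit.

(** * Injective words and the removal of an increasing run *)

(* Words are stored backwards: the head of the list is the last letter, so that
   the (0-based) position of x in x :: p is size p.  Absolute values are 0-based
   too. *)
Section InjectiveWords.
Variable N : nat.
Implicit Types (p : seq letter) (x : letter).

Definition letters (T : nat) : seq letter :=
  [seq (v, c) | c <- iota 0 N, v <- iota 0 T].

Fixpoint injw (T n : nat) : seq (seq letter) :=
  if n is m.+1 then
    [seq x :: p | p <- injw T m,
                  x <- [seq x <- letters T | x.1 \notin unzip1 p]]
  else [:: [::]].

Lemma mem_letters T x : (x \in letters T) = (x.1 < T)%N && (x.2 < N)%N.
Proof.
case: x => v c; apply/allpairsP/andP => [[[c' v'] /=]|[/= vT cN]].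
  by rewrite !mem_iota => -[cN vT [-> ->]].
by exists (c, v); rewrite !mem_iota.
Qed.

Lemma letters_uniq T : uniq (letters T).
Proof.
apply: allpairs_uniq; rewrite ?iota_uniq //.
by move=> [c v] [c' v'] _ _ [-> ->].
Qed.

Lemma mem_injw T n p : (p \in injw T n) =
  [&& size p == n, uniq (unzip1 p) & all [in letters T] p].
Proof.
elim: n p => [|n IHn] p; first by case: p => [|x p] //=; rewrite inE.
apply/allpairsPdep/idP => [[p' [x []]]|].
  rewrite IHn mem_filter => /and3P[/eqP sz_p Up Tp] /andP[px xT ->] /=.
  by rewrite sz_p eqxx px Up xT.
case: p => [|x p] //= /and3P[sz_p /andP[px Up] /andP[xT Tp]].
exists p, x; split; rewrite // ?IHn ?mem_filter ?px ?xT ?Up ?Tp ?andbT //.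
Qed.

Lemma injw_uniq T n : uniq (injw T n).
Proof.
elim: n => //= n IHn; apply: allpairs_uniq_dep => //.
  by move=> p _; rewrite filter_uniq ?letters_uniq.
by move=> [p x] [p' x'] _ _ /= [-> ->].
Qed.

Variable V : nmodType.
Implicit Types G : seq letter -> V.

Lemma sum_injwS T n G :
  \sum_(p <- injw T n.+1) G p =
  \sum_(p <- injw T n) \sum_(c <- iota 0 N) \sum_(v <- iota 0 T | v \notin unzip1 p)
     G ((v, c) :: p).
Proof.
rewrite big_allpairs_dep; apply: eq_bigr => p _.
rewrite big_filter big_mkcond big_allpairs_dep; apply: eq_bigr => c _.
by rewrite [RHS]big_mkcond.
Qed.

Definition bumpl (y : nat) x : letter := (bump y x.1, x.2).

Lemma mem_bump y v p :
  (bump y v \in unzip1 (map (bumpl y) p)) = (v \in unzip1 p).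
Proof.
rewrite /unzip1 -map_comp (map_comp (bump y) fst).
by rewrite mem_map //; apply: can_inj (bumpK y).
Qed.

Lemma sum_iota_bump y T (P : pred nat) (F : nat -> V) : (y <= T)%N ->
  \sum_(v <- iota 0 T.+1 | (y != v) && P v) F v =
  \sum_(v <- iota 0 T | P (bump y v)) F (bump y v).
Proof.
move=> yT; rewrite -big_filter_cond.
rewrite -(big_map (bump y) P F); apply: perm_big; apply: uniq_perm.
- by rewrite filter_uniq ?iota_uniq.
- by rewrite map_inj_uniq ?iota_uniq //; apply: can_inj (bumpK y).
move=> v; rewrite mem_filter mem_iota; apply/andP/mapP => [[yv vT]|[w]].
  exists (unbump y v); last by rewrite unbumpK // inE eq_sym.
  by rewrite mem_iota /unbump; move: yv vT yT; case: ltnP; lia.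
by rewrite mem_iota => wT ->; rewrite neq_bump /bump; case: leqP; lia.
Qed.

(** [bump y] maps the values below [T] bijectively onto those below [T.+1] other than [y]. *)
Lemma sum_injw_bump T n y G : (y <= T)%N ->
  \sum_(p <- injw T.+1 n | y \notin unzip1 p) G p =
  \sum_(p <- injw T n) G (map (bumpl y) p).
Proof.
move=> yT; elim: n G => [|n IHn] G; first by rewrite /= !big_cons !big_nil.
rewrite big_mkcond !sum_injwS.
transitivity (\sum_(p <- injw T.+1 n | y \notin unzip1 p)
    \sum_(c <- iota 0 N) \sum_(v <- iota 0 T.+1 | (y != v) && (v \notin unzip1 p))
      G ((v, c) :: p)).
  rewrite [RHS]big_mkcond; apply: eq_bigr => p _ /=.
  case: ifPn => [py|]; last first.
    rewrite negbK => py; rewrite big1 // => c _; rewrite big1 // => v _.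
    by rewrite inE py orbT.
  apply: eq_bigr => c _; rewrite [LHS]big_mkcond [RHS]big_mkcond /=.
  by apply: eq_bigr => v _; rewrite inE negb_or py andbT; case: eqP; case: ifP.
rewrite IHn; apply: eq_bigr => p _; apply: eq_bigr => c _.
rewrite sum_iota_bump //; apply: eq_big => // v.
by rewrite mem_bump.
Qed.

End InjectiveWords.

(** * Splitting off an increasing run *)

Section Weights.
Variables (N : nat) (R : comNzRingType).
Implicit Types (p : seq letter) (Psi : seq letter -> R) (w : nat -> nat -> R).

Definition head_lt (b : nat) p := if p is x :: _ then (x.1 < b)%N else false.

(* The sum of the weights of the increasing words of length l that can be
   appended to p and whose letters are smaller than b; w v i is the weight of
   the letter v in position i. *)
Fixpoint incsum w p (l b : nat) : R :=
  if l is k.+1 then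
    \sum_(v <- iota 0 b | v \notin unzip1 p) w v (size p + k)%N * incsum w p k v
  else 1.

(* The sum of Psi p' * (weight of L) over the ways to write p as p' followed by
   a nonempty increasing word L of color c. *)
Fixpoint run w Psi (c : nat) p : R :=
  if p is x :: p' then
    if x.2 == c then
      w x.1 (size p') * (Psi p' + if head_lt x.1 p' then run w Psi c p' else 0)
    else 0
  else 0.

(** An increasing run that ends below [v] cannot contain [v], so that avoiding [v] is a condition on
    the prefix alone. *)
Lemma run_avoid w Psi c v p : head_lt v p ->
  run w (fun p => if v \notin unzip1 p then Psi p else 0) c p =
  if v \notin unzip1 p then run w Psi c p else 0.
Proof.
elim: p => //= x p IHp xv; case: eqP => _; last by case: ifP.
rewrite inE negb_or eq_sym neq_ltn xv /=.
case: (boolP (head_lt x.1 p)) => [px|_].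
  rewrite IHp; last by case: p px {IHp} => //= y p /ltn_trans; apply.
  by case: ifP; rewrite // addr0 mulr0.
by rewrite !addr0; case: ifP; rewrite // mulr0.
Qed.

Lemma sum_iota_lt (V : nmodType) T b (P : pred nat) (F : nat -> V) : (b <= T)%N ->
  \sum_(v <- iota 0 T | P v) (if (v < b)%N then F v else 0) =
  \sum_(v <- iota 0 b | P v) F v.
Proof.
move=> bT; rewrite -{1}(subnKC bT) iotaD big_cat /= [X in _ + X]big1_seq ?addr0.
  by rewrite [LHS]big_seq_cond [RHS]big_seq_cond; apply: eq_bigr => v;
     rewrite mem_iota => /andP[/= ->].
by move=> v /andP[_]; rewrite mem_iota => /andP[bv _]; rewrite ltnNge bv.
Qed.

Lemma sum_run_last w Psi c T n b : (c < N)%N -> (b <= T)%N ->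
  \sum_(p <- injw N T n.+1 | head_lt b p) run w Psi c p =
  \sum_(p <- injw N T n) \sum_(v <- iota 0 b | v \notin unzip1 p)
    w v (size p) * (Psi p + if head_lt v p then run w Psi c p else 0).
Proof.
move=> cN bT; rewrite big_mkcond sum_injwS; apply: eq_bigr => p _.
rewrite (bigD1_seq c) ?iota_uniq ?mem_iota //= [X in _ + X]big1 ?addr0.
  by rewrite eqxx sum_iota_lt.
by move=> c' /negPf c'c; rewrite big1 // => v _; rewrite c'c; case: ifP.
Qed.

(** Remove the last letter [v] and apply the induction hypothesis with the bound [v] and with [Psi]
    restricted to the prefixes that avoid [v]. *)
Lemma sum_run w Psi c T n b : (c < N)%N -> (b <= T)%N ->
  \sum_(p <- injw N T n.+1 | head_lt b p) run w Psi c p =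
  \sum_(l < n.+1) \sum_(p <- injw N T (n - l)) Psi p * incsum w p l.+1 b.
Proof.
move=> cN; elim: n Psi b => [|n IHn] Psi b bT.
all: rewrite sum_run_last //.
  rewrite big_ord1 /= !big_seq1 /= mulr_sumr.
  by apply: eq_bigr => v _; rewrite addr0 mulr1 mulrC.
rewrite [RHS]big_ord_recl subn0.
under eq_bigr => p _ do under eq_bigr => v _ do rewrite mulrDr.
under eq_bigr => p _ do rewrite big_split.
rewrite big_split; congr (_ + _).
  rewrite [LHS]big_seq [RHS]big_seq; apply: eq_bigr => p.
  rewrite mem_injw => /and3P[/eqP sz_p _ _]; rewrite mulr_sumr.
  by apply: eq_bigr => v _; rewrite addn0 mulr1 mulrC.
transitivity (\sum_(v <- iota 0 b) w v n.+1 *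
   \sum_(p <- injw N T n.+1 | head_lt v p)
      run w (fun p => if v \notin unzip1 p then Psi p else 0) c p).
  under eq_bigr => p _ do rewrite big_mkcond.
  rewrite exchange_big; apply: eq_bigr => v _; rewrite mulr_sumr [RHS]big_mkcond.
  rewrite [LHS]big_seq [RHS]big_seq; apply: eq_bigr => p.
  rewrite mem_injw => /and3P[/eqP -> _ _].
  case: (boolP (head_lt v p)) => pv; last by case: ifP; rewrite // mulr0.
  by rewrite run_avoid //; case: ifP; rewrite // mulr0.
transitivity (\sum_(v <- iota 0 b) \sum_(l < n.+1)
   \sum_(p <- injw N T (n - l) | v \notin unzip1 p)
      w v n.+1 * (Psi p * incsum w p l.+1 v)).
  rewrite [LHS]big_seq [RHS]big_seq; apply: eq_bigr => v.
  rewrite mem_iota => /andP[_ vb]; rewrite IHn; last exact: ltnW (leq_trans vb bT).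
  rewrite mulr_sumr; apply: eq_bigr => l _; rewrite mulr_sumr [RHS]big_mkcond.
  by apply: eq_bigr => p _; case: ifP; rewrite // mul0r mulr0.
rewrite exchange_big; apply: eq_bigr => l _ /=.
under eq_bigr => v _ do rewrite big_mkcond.
rewrite exchange_big subSS [LHS]big_seq [RHS]big_seq; apply: eq_bigr => p.
rewrite mem_injw => /and3P[/eqP sz_p _ _]; rewrite -big_mkcond mulr_sumr.
apply: eq_bigr => v _; rewrite sz_p -/(incsum w p l.+1 v) mulrCA.
by rewrite /bump add1n addnS subnK // -ltnS.
Qed.

Lemma incsum_bump w p l y b : (b <= y)%N ->
  incsum w (map (bumpl y) p) l b = incsum w p l b.
Proof.
elim: l b => //= l IHl b b_y.
rewrite [LHS]big_seq_cond [RHS]big_seq_cond; apply: eq_big => v.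
  rewrite mem_iota; case: ltnP => //= vb.
  by rewrite -(mem_bump y v p) /bump leqNgt (leq_trans vb b_y).
rewrite mem_iota size_map => /andP[/andP[_ vb] _]; rewrite IHl //.
exact: ltnW (leq_trans vb b_y).
Qed.

(** If the last letter of an increasing word is smaller than its position, then so are all the
    others. *)
Lemma eq_incsum w w' p l b :
    (forall v i, (v < i)%N -> w v i = w' v i) -> (b < size p + l)%N ->
  incsum w p l b = incsum w' p l b.
Proof.
move=> ww'; elim: l b => //= l IHl b; rewrite addnS ltnS => b_pl.
rewrite [LHS]big_seq_cond [RHS]big_seq_cond; apply: eq_bigr => v.
rewrite mem_iota => /andP[/andP[_ /leq_trans/(_ b_pl) v_pl] _].
by rewrite ww' ?IHl.
Qed.

Lemma incsumSS w p l b : incsum w p l.+1 b.+1 = incsum w p l.+1 b +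
  if b \notin unzip1 p then w b (size p + l)%N * incsum w p l b else 0.
Proof.
rewrite -(addn1 b) /= iotaD big_cat /= add0n; congr (_ + _).
by rewrite big_mkcond big_seq1.
Qed.

(** An increasing word is determined by the set of its letters. *)
Lemma incsum_const (x : R) p l b : incsum (fun _ _ => x) p l b =
  x ^+ l *+ 'C(count [predC unzip1 p] (iota 0 b), l).
Proof.
elim: l b => [|l IHl] b; first by rewrite bin0.
elim: b => [|b IHb]; first by rewrite /= big_nil bin0n mulr0n.
rewrite incsumSS IHb IHl -(addn1 b) iotaD count_cat /= add0n addn0.
case: ifP => _; last by rewrite addr0 addn0.
by rewrite addn1 binS mulrnDr mulrnAr -exprS.
Qed.

Lemma count_avoid T n p : p \in injw N T n ->
  count [predC unzip1 p] (iota 0 T) = (T - n)%N.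
Proof.
rewrite mem_injw => /and3P[/eqP sz_p Up Tp].
suff Ec : count [in unzip1 p] (iota 0 T) = n.
  by rewrite -[T in RHS](size_iota 0) -(count_predC [in unzip1 p]) Ec addKn.
rewrite -sz_p -(size_map fst p) -/(unzip1 p) -size_filter.
apply: perm_size; apply: uniq_perm => //.
  by rewrite filter_uniq ?iota_uniq.
move=> v; rewrite mem_filter mem_iota add0n.
case: (boolP (v \in _)) => //= /mapP[x xp ->].
by have := allP Tp x xp; rewrite /= mem_letters => /andP[].
Qed.

(** * Insertion of the run into the gaps *)

Section Peel.
Variables (w : nat -> nat -> R) (Psi : seq letter -> R) (n m : nat).
Hypothesis Psi_bump : forall p y, (size p <= y)%N -> Psi (map (bumpl y) p) = Psi p.

(* Only the appended letters v with fewer than k non-appended values in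
   [n, v[ are allowed. *)
Let B k l := \sum_(p <- injw N (n + m + l) n) Psi p * incsum w p l (n + k + l).-1.

(* If the largest allowed letter y is appended, it can be removed together with
   the value y: the letters of p larger than y are larger than size p as well,
   before and after the removal. *)
Let peel_step k l : (k <= m)%N ->
  B k.+1 l.+1 = B k l.+1 + w (n + k + l)%N (n + l)%N * B k.+1 l.
Proof.
move=> km; rewrite /B !addnS addSn !succnK; set y := (n + k + l)%N.
have yT : (y <= n + m + l)%N by rewrite leq_add2r leq_add2l.
under eq_bigr => p _ do rewrite incsumSS mulrDr.
rewrite big_split; congr (_ + _).
transitivity (\sum_(p <- injw N (n + m + l).+1 n | y \notin unzip1 p)
   Psi p * (w y (size p + l)%N * incsum w p l y)).
  rewrite [RHS]big_mkcond; apply: eq_bigr => p _.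
  by case: ifP; rewrite // mulr0.
rewrite sum_injw_bump // mulr_sumr [LHS]big_seq [RHS]big_seq.
apply: eq_bigr => p; rewrite mem_injw => /and3P[/eqP sz_p _ _].
rewrite incsum_bump // size_map sz_p Psi_bump 1?mulrCA //.
by rewrite sz_p /y -addnA leq_addr.
Qed.

(** In generating functions over [l], the step above reads (1 - c z) B_(k+1) = B_k. Here c = f for k
    = 0, where the removed letter equals its position, and c = e for the other m gaps, where it
    exceeds it. In B_0 every appended letter is smaller than its position. *)
Lemma peel (a f e : R) :
    (forall v i, (v < i)%N -> w v i = a) -> (forall i, w i i = f) ->
    (forall v i, (i < v)%N -> w v i = e) ->
  lin f * lin e ^+ m * FPS (fun l =>
    \sum_(p <- injw N (n + m + l) n) Psi p * incsum w p l (n + m + l)) =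
  FPS (fun l =>
    \sum_(p <- injw N (n + m + l) n) Psi p * incsum (fun _ _ => a) p l (n + l).-1).
Proof.
move=> wa wf we.
have step k c : (k <= m)%N -> (forall l, w (n + k + l)%N (n + l)%N = c) ->
    lin c * FPS (B k.+1) = FPS (B k).
  move=> km wc; apply/fpsP => -[|l]; rewrite fcoef_linM.
    by rewrite subr0; apply: eq_bigr.
  by rewrite [fcoef (FPS (B _)) l.+1]peel_step // wc addrK.
have -> : FPS (fun l =>
    \sum_(p <- injw N (n + m + l) n) Psi p * incsum w p l (n + m + l)) = FPS (B m.+1).
  by apply/fpsP => l /=; rewrite /B addnS addSn.
have E k : (k <= m)%N -> lin e ^+ k * FPS (B k.+1) = FPS (B 1).
  elim: k => [|k IHk] km; first by rewrite mul1r.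
  rewrite exprSr -mulrA step ?IHk // 1?ltnW // => l.
  by apply: we; rewrite ltn_add2r -[ltnLHS]addn0 ltn_add2l.
rewrite -mulrA E // step // => [|l]; last by rewrite addn0 wf.
apply/fpsP => -[|l]; rewrite /= /B ?addn0 //.
rewrite [LHS]big_seq [RHS]big_seq; apply: eq_bigr => p.
rewrite mem_injw => /and3P[/eqP sz_p _ _]; congr (_ * _).
by apply: eq_incsum => //; rewrite sz_p addnS.
Qed.

End Peel.

Lemma peel_const Psi n m (a : R) :
    (forall p y, (size p <= y)%N -> Psi (map (bumpl y) p) = Psi p) ->
  lin a ^+ m.+1 * FPS (fun l =>
    a ^+ l *+ 'C(m + l, l) * \sum_(p <- injw N (n + m + l) n) Psi p) =
  FPS (fun l =>
    \sum_(p <- injw N (n + m + l) n) Psi p * incsum (fun _ _ => a) p l (n + l).-1).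
Proof.
move=> Psi_bump; rewrite -(@peel (fun _ _ => a) Psi n m _ a a a) // -exprS.
congr (_ * _); apply/fpsP => l /=; rewrite mulr_sumr.
rewrite [LHS]big_seq [RHS]big_seq; apply: eq_bigr => p pT.
by rewrite incsum_const (count_avoid pT) -addnA addKn mulrC.
Qed.

End Weights.

(** * q-analogs and the recursion for words *)

(* qint, qfact, expq and Expq over a ring in which all [n]_q are invertible. *)
Section QAnalogs.
Variables (R : comUnitRingType) (q : R).

Definition qnum (n : nat) : R := \sum_(i < n) q ^+ i.
Definition qfac (n : nat) : R := \prod_(1 <= j < n.+1) qnum j.
Definition qexp : fps R := FPS (fun i => (qfac i)^-1).
Definition qExp : fps R := FPS (fun i => q ^+ 'C(i, 2) / qfac i).

Hypothesis qnum_unit : forall n, (0 < n)%N -> qnum n \is a GRing.unit.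

Lemma qnumE n : (1 - q) * qnum n = 1 - q ^+ n.
Proof.
rewrite -[1 in RHS](expr1n R n) subrXX; congr (_ * _).
by apply: eq_bigr => i _; rewrite expr1n mul1r.
Qed.

Lemma qfac0 : qfac 0 = 1.
Proof. by rewrite /qfac big_geq. Qed.

Lemma qfacS n : qfac n.+1 = qfac n * qnum n.+1.
Proof. by rewrite /qfac big_nat_recr. Qed.

Lemma qfac_unit n : qfac n \is a GRing.unit.
Proof.
elim: n => [|n IHn]; first by rewrite qfac0 unitr1.
by rewrite qfacS unitrM IHn qnum_unit.
Qed.

Lemma qfacV n : (1 - q ^+ n.+1) / qfac n.+1 = (1 - q) / qfac n.
Proof.
rewrite -qnumE qfacS invrM ?qfac_unit ?qnum_unit // -mulrA; congr (_ * _).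
by rewrite mulVKr ?qnum_unit.
Qed.
End QAnalogs.

Section Words.
Variables (N : nat) (R : comUnitRingType) (q : R) (a f e : nat -> R).
Implicit Types (p : seq letter) (x : letter).
Hypothesis qnum_unit : forall n, (0 < n)%N -> qnum q n \is a GRing.unit.

(* a, f and e give the weight of a letter according to its color, when it is
   smaller than, equal to, or greater than its position. *)
Definition wt x (i : nat) : R :=
  if (x.1 < i)%N then a x.2 else if x.1 == i then f x.2 else e x.2.

Fixpoint wtw p : R := if p is x :: p' then wt x (size p') * wtw p' else 1.

Definition head_des x p : bool := if p is y :: _ then ltl x y else false.

Fixpoint majw p : nat :=
  if p is x :: p' then (majw p' + head_des x p' * size p')%N else 0%N.

Definition gw p : R := q ^+ majw p * wtw p / qfac q (size p).

(* Interpolates between psi N p = q ^+ size p * gw p and psi 0 p = gw p: only runs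
   of colors >= c are allowed on the positions of the part 0. *)
Definition psi (c : nat) p : R :=
  (if (if p is x :: _ then (c <= x.2)%N else true) then 1 else q ^+ size p) * gw p.

(* The part of psi c p due to a nonempty last run of color c. *)
Definition last_run (c : nat) p : R :=
  if (if p is x :: _ then x.2 == c else false) then (1 - q ^+ size p) * gw p else 0.

Lemma psiS c p : psi c p = psi c.+1 p + last_run c p.
Proof.
rewrite /psi /last_run; case: p => [|x p]; first by rewrite addr0.
by case: (ltngtP c x.2) => _; rewrite ?addr0 //; ring.
Qed.

(** Deleting the last of n + 1 letters turns (1 - q^(n+1)) / [n+1]_q! into (1 - q) / [n]_q!, whence
    the factor 1 - q for each letter of the run; a descent in front of the letter leaves a factor
    q^n. *)
Lemma last_runE c p : uniq (unzip1 p) ->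
  last_run c p = run (fun v i => (1 - q) * wt (v, c) i) (psi c.+1) c p.
Proof.
elim: p => // x p IHp /= /andP[x_p Up]; rewrite -IHp // {IHp Up}.
rewrite /last_run /=; case: eqP => // xc.
transitivity ((1 - q) * wt x (size p) * (q ^+ (head_des x p * size p) * gw p)).
  rewrite {1}/gw [LHS]mulrCA qfacV // /gw /= exprD.
  by ring.
rewrite [wt (x.1, c) _]/wt /= -xc; congr (_ * _); rewrite /psi.
case: p x_p => [|y p] /=; first by rewrite addr0.
rewrite inE negb_or /ltl => /andP[xy _].
(* A smaller color before [x] makes a descent, a larger one does not. For equal colors without a
   descent, 1 = q^n + (1 - q^n) splits off the continued run. *)
case: ltngtP => //= [xy2|xy2|xy2].
- by rewrite mul1n; case: ifP => _; rewrite addr0.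
- by rewrite mul0n mul1r; case: ifP => _; rewrite addr0.
case: ltngtP xy => //= xy1 _; rewrite ?mul0n ?mul1n ?addr0 //.
by ring.
Qed.

(** A letter raised by [bump y] has value at least [y], hence exceeds its position before and
    after. *)
Lemma wtw_bump y p : (size p <= y)%N -> wtw (map (bumpl y) p) = wtw p.
Proof.
elim: p => //= x p IHp p_y; rewrite IHp 1?ltnW // size_map; congr (_ * _).
rewrite /wt /= /bump; case: (leqP y x.1) => // yx.
by rewrite !ifF //; lia.
Qed.

Lemma majw_bump y p : majw (map (bumpl y) p) = majw p.
Proof.
elim: p => //= x p ->; rewrite size_map; congr (_ + _ * _)%N.
case: p => //= z p; rewrite /ltl /bumpl /=; congr (nat_of_bool (_ || (_ && _))).
by rewrite /bump; lia.
Qed.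

Lemma psi_bump c y p : (size p <= y)%N -> psi c (map (bumpl y) p) = psi c p.
Proof.
move=> p_y; rewrite /psi /gw majw_bump wtw_bump // size_map.
by case: p {p_y}.
Qed.

Definition wgf (c m : nat) : fps R :=
  FPS (fun n => \sum_(p <- injw N (n + m) n) psi c p).

(** Sort the words by the length of the prefix before the run of color [c], which may be empty; for
    each such length, [peel] and [peel_const] apply to the series in the length of the run. *)
Lemma wgf_rec c m : (c < N)%N ->
  lin ((1 - q) * f c) * lin ((1 - q) * e c) ^+ m * wgf c m =
  lin ((1 - q) * a c) ^+ m.+1 *
    zsum (fun l => fpsC (((1 - q) * a c) ^+ l *+ 'C(m + l, l)) * wgf c.+1 (m + l)).
Proof.
move=> cN; pose w v i := (1 - q) * wt (v, c) i.
have E : wgf c m = zsum (fun n => FPS (fun l =>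
    \sum_(p <- injw N (n + m + l) n) psi c.+1 p * incsum w p l (n + m + l))).
  rewrite zsum_flip; apply/fpsP => n /=.
  under [in RHS]eq_bigr => l _ do rewrite addnAC subnK -1?ltnS //.
  rewrite big_ord_recl subn0.
  under [in RHS]eq_bigr => p _ do rewrite mulr1.
  under eq_bigr => p _ do rewrite psiS.
  rewrite big_split; congr (_ + _).
  case: n => [|n]; first by rewrite big_ord0 big_seq1.
  rewrite -(sum_run w (psi c.+1) n cN (leqnn _)) [RHS]big_mkcond.
  rewrite [LHS]big_seq [RHS]big_seq; apply: eq_bigr => p.
  rewrite mem_injw => /and3P[sz_p Up Tp]; rewrite last_runE //.
  by case: p {sz_p Up} Tp => //= x p /andP[]; rewrite mem_letters => /andP[->].
rewrite E -zsumM; under eq_zsum => n.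
  rewrite (@peel _ _ _ _ _ _ _ ((1 - q) * a c)); first last.
  - by move=> v i iv; rewrite /w /wt /= ltnNge ltnW //= gtn_eqF.
  - by move=> i; rewrite /w /wt /= ltnn eqxx.
  - by move=> v i vi; rewrite /w /wt /= vi.
  - by move=> p y py; exact: psi_bump.
  rewrite -peel_const; last by move=> p y py; exact: psi_bump.
over.
rewrite zsumM zsum_flip; congr (_ * _); apply: eq_zsum => l.
by apply/fpsP => n; rewrite fcoefCM /= addnA.
Qed.

Lemma wgf_last m : wgf N m = dilate q (wgf 0 m).
Proof.
apply/fpsP => n /=; rewrite mulr_sumr [LHS]big_seq [RHS]big_seq.
apply: eq_bigr => p; rewrite mem_injw => /and3P[/eqP <- _].
rewrite /psi; case: p => [|x p] /=; first by rewrite !mul1r.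
by rewrite mem_letters => /andP[/andP[_ xN] _]; rewrite leqNgt xN mul1r.
Qed.

Lemma wgf_coef0 c m : fcoef (wgf c m) 0 = 1.
Proof. by rewrite /= big_seq1 /psi /gw /= qfac0 divr1 !mul1r. Qed.

End Words.

(** * Uniqueness and solution of the peeling system *)

Lemma fcoefM_low (R : comNzRingType) (f g : fps R) n :
  (forall k, (k < n)%N -> fcoef g k = 0) -> fcoef (f * g) n = fcoef f 0 * fcoef g n.
Proof.
move=> g0; rewrite fcoefM big_ord_recl subn0 big1 ?addr0 // => i _.
by rewrite g0 ?mulr0 // lift0; case: n i {g0} => [[]//|n i]; lia.
Qed.

Section PeelingSystem.
Variables (R : comUnitRingType) (N : nat) (q : R) (al ph ep : nat -> R).
Implicit Types (P Q : nat -> nat -> fps R).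

Definition peeling_system P : Prop :=
  (forall c m, (c < N)%N -> lin (ph c) * lin (ep c) ^+ m * P c m =
     lin (al c) ^+ m.+1 *
       zsum (fun l => fpsC (al c ^+ l *+ 'C(m + l, l)) * P c.+1 (m + l)%N)) /\
  (forall m, P N m = dilate q (P 0%N m)).

Lemma peeling_systemB P Q : peeling_system P -> peeling_system Q ->
  peeling_system (fun c m => P c m - Q c m).
Proof.
move=> [P1 PN] [Q1 QN]; split=> [c m cN|m]; last by rewrite PN QN rmorphB.
rewrite mulrBr P1 // Q1 // -mulrBr; congr (_ * _).
by rewrite -zsumB; apply: eq_zsum => l; rewrite mulrBr.
Qed.

Hypothesis q_lreg : forall n, (0 < n)%N -> GRing.lreg (1 - q ^+ n).

(* Up to the first nonzero coefficients, all the P c m agree; comparing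
   P N m with P 0 m thus makes these coefficients vanish. *)
Lemma peeling_system_eq0 P : peeling_system P ->
  (forall m, fcoef (P 0%N m) 0 = 0) -> forall m, P 0%N m = 0.
Proof.
move=> [P1 PN] P0 m; apply/fpsP => n; rewrite fcoef0.
elim/ltn_ind: n m => -[//|n] IHn m.
suff: fcoef (P 0%N m) n.+1 = fcoef (P N m) n.+1.
  move=> E; apply: (q_lreg (ltn0Sn n)); rewrite mulr0 mulrBl mul1r.
  by rewrite {1}E PN subrr.
(* Downward induction on the color [N - j]: the factors [lin] have constant coefficient 1 and the
   terms [l > 0] carry z^l, so that neither affects the coefficient n + 1 while the lower ones
   vanish. *)
suff D j : (j <= N)%N -> forall m, (forall k, (k <= n)%N -> fcoef (P (N - j)%N m) k = 0)
    /\ fcoef (P (N - j)%N m) n.+1 = fcoef (P N m) n.+1.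
  by have [_] := D N (leqnn N) m; rewrite subnn.
elim: j => [_|j IHj jN] {}m.
  by rewrite subn0; split=> // k kn; rewrite PN /= IHn ?mulr0.
have := P1 (N - j.+1)%N; set c := (N - j.+1)%N.
have cS : c.+1 = (N - j)%N by rewrite /c subnSK.
move=> /(_ m); rewrite cS => /(_ _)/(canRL (mulKr _)) => [->]; last first.
- by rewrite /c; lia.
- by rewrite unitrM unitrX lin_unit.
set z := zsum _.
have z0 k : (k <= n)%N -> fcoef z k = 0.
  move=> kn; rewrite fcoef_zsum big1 // => i _; rewrite fcoefCM.
  have [z1 _] := IHj (ltnW jN) (m + i)%N; rewrite z1 ?mulr0 //.
  exact: leq_trans (leq_subr _ _) kn.
have zn : fcoef z n.+1 = fcoef (P N m) n.+1.
  rewrite fcoef_zsum big_ord_recl fcoefCM !addn0 bin0 mul1r subn0 big1 ?addr0.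
    by have [] := IHj (ltnW jN) m.
  move=> i _; rewrite fcoefCM.
  have [z1 _] := IHj (ltnW jN) (m + lift ord0 i)%N; rewrite z1 ?mulr0 //.
  by rewrite lift0 subSS leq_subr.
split=> [k kn|]; rewrite mulrA fcoefM_low => [|k' kk'].
- by rewrite z0 // mulr0.
- by rewrite z0 // (leq_trans _ kn) // ltnW.
- rewrite zn fcoefM0 fcoefV0 ?unitrM ?unitrX ?lin_unit //.
  by rewrite fcoefM0 !fcoefX0 !fcoef_lin0 !expr1n !mulr1 invr1 mul1r.
- by rewrite z0.
Qed.

Lemma peeling_system_inj P Q : peeling_system P -> peeling_system Q ->
    (forall m, fcoef (P 0%N m) 0 = fcoef (Q 0%N m) 0) ->
  forall m, P 0%N m = Q 0%N m.
Proof.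
move=> sP sQ PQ0 m; apply/eqP; rewrite -subr_eq0; apply/eqP.
apply: (peeling_system_eq0 (peeling_systemB sP sQ)) => {}m.
by rewrite fcoefD fcoefN PQ0 subrr.
Qed.

(** With this ansatz the sum over [l] is a negative binomial series, which turns the powers of
    [(J c.+1)^-1] into those of [(J c)^-1]; what remains separates into one equation each for [K],
    [J] and [rho]. *)
Lemma peeling_system_sol (K J rho : nat -> fps R) :
    (forall c, J c \is a GRing.unit) ->
    (forall c, (c < N)%N -> lin (ph c) * K c = lin (al c) * K c.+1) ->
    (forall c, (c < N)%N -> J c = J c.+1 - fpsC (al c) * fpsX * rho c.+1) ->
    (forall c, (c < N)%N -> lin (ep c) * rho c = lin (al c) * rho c.+1) ->
    K N = dilate q (K 0%N) -> J N = dilate q (J 0%N) ->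
    rho N = dilate q (rho 0%N) ->
  peeling_system (fun c m => K c * (J c)^-1 ^+ m.+1 * rho c ^+ m).
Proof.
move=> UJ Kc Jc rhoc KN JN rhoN; split=> [c m cN|m]; last first.
  by rewrite KN JN rhoN !rmorphM !rmorphXn rmorphV.
pose g := fpsC (al c) * (J c.+1)^-1 * rho c.+1.
have -> : zsum (fun l => fpsC (al c ^+ l *+ 'C(m + l, l)) *
      (K c.+1 * (J c.+1)^-1 ^+ (m + l).+1 * rho c.+1 ^+ (m + l))) =
    K c.+1 * (J c.+1)^-1 ^+ m.+1 * rho c.+1 ^+ m * (1 - fpsX * g)^-1 ^+ m.+1.
  have Ug : 1 - fpsX * g \is a GRing.unit.
    by apply: fps_unit1; rewrite fcoefD fcoefN fcoefXM subr0.
  have -> : (1 - fpsX * g)^-1 ^+ m.+1 = zsum (fun l => g ^+ l *+ 'C(m + l, l)).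
    apply: (mulrI (unitrX m.+1 Ug)).
    by rewrite zsum_binomial -exprMn mulrV // expr1n.
  rewrite -zsumM; apply: eq_zsum => l.
  rewrite rmorphMn rmorphXn /= mulrnAl mulrnAr; congr (_ *+ _).
  by rewrite /g -addSn !exprD !exprMn; ring.
have -> : J c = J c.+1 * (1 - fpsX * g).
  rewrite Jc // mulrBr mulr1 /g; congr (_ - _).
  by rewrite -[LHS]mul1r -(divrr (UJ c.+1)); ring.
rewrite invrM; first last.
- by apply: fps_unit1; rewrite fcoefD fcoefN fcoefXM subr0.
- exact: UJ.
rewrite exprMn.
transitivity ((lin (ph c) * K c) * ((1 - fpsX * g)^-1 ^+ m.+1 * (J c.+1)^-1 ^+ m.+1)
   * (lin (ep c) * rho c) ^+ m); first by rewrite [in RHS]exprMn; ring.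
by rewrite Kc // rhoc // [(lin _ * rho _) ^+ _]exprMn (exprS (lin _)); ring.
Qed.
End PeelingSystem.

(** * Closed form for words *)

Section ClosedForm.
Variables (R : comUnitRingType) (q : R).
Hypothesis qnum_unit : forall n, (0 < n)%N -> qnum q n \is a GRing.unit.
Hypothesis q1_lreg : GRing.lreg (1 - q).

Lemma lreg_1subX n : (0 < n)%N -> GRing.lreg (1 - q ^+ n).
Proof.
move=> n_gt0; rewrite -qnumE; apply: lregM q1_lreg _.
exact/mulrI/qnum_unit.
Qed.

Let E x := dilate x (qexp q).
Let G x := dilate (- x) (qExp q).

Lemma qexp_dilate x : dilate q (dilate x (qexp q)) =
  lin ((1 - q) * x) * dilate x (qexp q).
Proof.
apply/fpsP => n; rewrite fcoef_linM; case: n => [|n] /=.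
  by rewrite mul1r subr0.
transitivity (x ^+ n.+1 / qfac q n.+1 - x ^+ n.+1 * ((1 - q) / qfac q n)).
  by rewrite -qfacV //; ring.
by rewrite exprS; ring.
Qed.

Lemma qExp_dilate x : dilate (- x) (qExp q) =
  lin ((1 - q) * x) * dilate q (dilate (- x) (qExp q)).
Proof.
apply/fpsP => n; rewrite fcoef_linM; case: n => [|n] /=.
  by rewrite subr0 expr0 [RHS]mul1r.
rewrite binS bin1 exprD; move: 'C(n, 2) => k.
transitivity ((- x) ^+ n.+1 * q ^+ k * q ^+ n *
  (q ^+ n.+1 / qfac q n.+1 + (1 - q) / qfac q n)).
  by rewrite -qfacV //; ring.
by rewrite !exprS; ring.
Qed.

Lemma qexp0 x : fcoef (E x) 0 = 1.
Proof. by rewrite /= qfac0 invr1 mulr1. Qed.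

Lemma qExp0 x : fcoef (G x) 0 = 1.
Proof. by rewrite /= qfac0 divr1 !mulr1. Qed.

(** By the q-difference equations of its factors, the product is invariant under z -> q z; it is
    constant because 1 - q^n is regular for n > 0. *)
Lemma qexp_qExp x : dilate x (qexp q) * dilate (- x) (qExp q) = 1.
Proof.
have D : dilate q (E x * G x) = E x * G x.
  by rewrite rmorphM /= qexp_dilate [in RHS]/G qExp_dilate /E /G; ring.
apply/fpsP => -[|n]; first by rewrite fcoefM0 [fcoef _ _]qexp0 [fcoef _ _]qExp0 mul1r.
have Dn : q ^+ n.+1 * fcoef (E x * G x) n.+1 = fcoef (E x * G x) n.+1.
  by rewrite -{2}D.
apply: (lreg_1subX (ltn0Sn n)).
by rewrite mulrBl mul1r [X in _ - X]Dn subrr fcoef1 mulr0.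
Qed.

(** * Explicit series for the weights of colored permutations *)

Variables (N : nat) (t : R) (r s : nat -> R).
Hypothesis N_gt0 : (0 < N)%N.
Hypothesis tq_unit : 1 - t * q \is a GRing.unit.

(** Only in color 0 is a letter above its position an excedance, whence [t]; any other color
    contributes [s c] in all three cases. *)
Definition wlt (c : nat) : R := if c is 0 then 1 else s c.
Definition weq (c : nat) : R := r c * wlt c.
Definition wgt (c : nat) : R := if c is 0 then t else s c.

Let S : R := \sum_(1 <= m < N) s m.
Let kap c : fps R := G (wlt c) * E (weq c).
(** Dilating one factor per color leads from [K 0] to its dilate [K N]. *)
Let K c : fps R := dilate q (\prod_(0 <= k < c) kap k) * \prod_(c <= k < N) kap k.
Let rho0 : fps R := E t * G 1.
(** For c > 0, [wlt] and [wgt] agree, so that [rho] changes at color 0 only. *)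
Let rho c : fps R := if c is 0 then rho0 else dilate q rho0.
(** Solution of J0(q z) - J0(z) = (1 - q) (1 + S) z rho0(q z); the term [t * q + S] makes the
    constant coefficient 1. *)
Let J0 : fps R := fpsC (1 - t * q)^-1 *
  (fpsC (1 + S) * E (t * q) * G 1 - fpsC (t * q + S)).
Let J c : fps R := dilate q J0 -
  fpsC (\sum_(c <= k < N) (1 - q) * wlt k) * fpsX * dilate q rho0.

Let sum_wlt : \sum_(0 <= k < N) wlt k = 1 + S.
Proof.
by rewrite big_ltn //; congr (_ + _); apply: eq_big_nat => -[].
Qed.

Let J_0 : J 0 = J0.
Proof.
have uv : fpsC (1 - t * q)^-1 * (1 - fpsC t * fpsC q) = 1 :> fps R.
  by rewrite -(rmorph1 (@fpsC R)) -[_ * fpsC q]rmorphM -rmorphB -rmorphM mulVr.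
have linC c : lin ((1 - q) * c) = 1 - fpsC (1 - q) * fpsC c * fpsX.
  by rewrite /lin rmorphM.
rewrite /J -mulr_sumr sum_wlt rmorphM.
rewrite /J0 /rho0 !rmorphM rmorphB !rmorphM /= !dilateC.
rewrite /E /G qexp_dilate [in RHS]qExp_dilate !dilate_comp !linC.
rewrite !rmorphM rmorph1 [q * t]mulrC.
apply/eqP; rewrite -subr_eq0; apply/eqP.
transitivity ((fpsC (1 - t * q)^-1 * (1 - fpsC t * fpsC q) - 1) *
  (fpsC (1 - q) * fpsC (1 + S) * fpsX *
  (dilate (t * q) (qexp q) * dilate (q * -1) (qExp q)))); first by ring.
by rewrite uv subrr mul0r.
Qed.

Let coef0_J0 : fcoef J0 0 = 1.
Proof.
rewrite /J0 fcoefM0 fcoefD fcoefN !fcoefM0 [fcoef (E _) _]qexp0 [fcoef (G _) _]qExp0.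
by rewrite /= !mulr1 opprD addrACA subrr addr0 mulVr.
Qed.

Let unit_J c : J c \is a GRing.unit.
Proof.
apply: fps_unit1; rewrite /J fcoefD fcoefN -mulrA fcoefCM fcoefXM mulr0 subr0.
by rewrite [LHS]mul1r coef0_J0.
Qed.

Theorem wgf_closed_form :
  wgf N q wlt weq wgt 0 0 *
    (fpsC (1 + S) * E (t * q) - fpsC (t * q + S) * E 1) =
  E (r 0%N) * fpsC (1 - t * q) * \prod_(1 <= m < N) (G (s m) * E (r m * s m)).
Proof.
have sys : peeling_system N q (fun c => (1 - q) * wlt c) (fun c => (1 - q) * weq c)
    (fun c => (1 - q) * wgt c) (fun c m => wgf N q wlt weq wgt c m).
  split=> [c m cN|m]; first exact: wgf_rec.
  exact: wgf_last.
have kapE c : lin ((1 - q) * weq c) * kap c = lin ((1 - q) * wlt c) * dilate q (kap c).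
  by rewrite /kap rmorphM /= /E qexp_dilate [in LHS]/G qExp_dilate; rewrite /G; ring.
have sol : peeling_system N q (fun c => (1 - q) * wlt c) (fun c => (1 - q) * weq c)
    (fun c => (1 - q) * wgt c) (fun c m => K c * (J c)^-1 ^+ m.+1 * rho c ^+ m).
  apply: peeling_system_sol => // [c cN|c cN|[|c] cN|||].
  - rewrite /K [\prod_(c <= k < N) _]big_ltn // big_nat_recr //= rmorphM /=.
    transitivity (dilate q (\prod_(0 <= k < c) kap k) *
      (lin ((1 - q) * weq c) * kap c) * \prod_(c.+1 <= k < N) kap k); first by ring.
    by rewrite kapE; ring.
  - rewrite /J [\sum_(c <= k < N) _]big_ltn // rmorphD /=.
    by ring.
  - rewrite /= /rho0 rmorphM /= /E qexp_dilate [in LHS]/G qExp_dilate /G mulr1; ring.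
  - by [].
  - by rewrite /K !(big_geq (leqnn _)) mulr1 rmorph1 mul1r.
  - by rewrite J_0 /J big_geq // rmorph0 !mul0r subr0.
  - by rewrite /rho; case: (N) N_gt0.
have -> : wgf N q wlt weq wgt 0 0 = K 0 * (J 0)^-1 ^+ 1 * rho 0 ^+ 0.
  apply: (peeling_system_inj lreg_1subX sys sol) => m.
  rewrite wgf_coef0 J_0 !fcoefM0 !fcoefX0 fcoefV0 -?J_0 // J_0 coef0_J0.
  rewrite invr1 expr1n mulr1.
  rewrite /rho0 fcoefM0 [fcoef (E _) _]qexp0 [fcoef (G _) _]qExp0 mulr1 expr1n mulr1.
  rewrite /K big_geq // rmorph1 mul1r fcoef_prod0 big1 // => k _.
  by rewrite fcoefM0 [fcoef (E _) _]qexp0 [fcoef (G _) _]qExp0 mulr1.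
have EG : E 1 * G 1 = 1 by apply: qexp_qExp.
have UC : fpsC (1 - t * q) \is a GRing.unit by [].
have -> : fpsC (1 + S) * E (t * q) - fpsC (t * q + S) * E 1 = fpsC (1 - t * q) * J0 * E 1.
  transitivity (fpsC (1 - t * q) * fpsC (1 - t * q)^-1 *
    (fpsC (1 + S) * E (t * q) * (E 1 * G 1) - fpsC (t * q + S) * E 1)).
    by rewrite EG -rmorphM mulrV // rmorph1 mul1r mulr1.
  by rewrite /J0; ring.
transitivity (K 0 * fpsC (1 - t * q) * E 1 * (J0^-1 * J0)).
  by rewrite J_0; ring.
rewrite mulVr -?J_0 // mulr1.
rewrite /K big_geq // rmorph1 mul1r big_ltn // /kap /weq /= mulr1.
rewrite (eq_big_nat _ _ (F2 := fun m => G (s m) * E (r m * s m))) => [|[]//].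
(* The factor [G 1] of [kap 0] cancels the [E 1] from the denominator. *)
transitivity (E (r 0%N) * fpsC (1 - t * q) *
  \prod_(1 <= m < N) (G (s m) * E (r m * s m)) * (E 1 * G 1)); first by ring.
by rewrite EG mulr1 -mulrA.
Qed.
End ClosedForm.

(** * From colored permutations to words *)

Section ColoredPermutationWords.
Variable N : nat.

Definition rev_word (g : nat -> letter) (n : nat) : seq letter :=
  [seq g i | i <- rev (iota 0 n)].

Lemma rev_wordS g n : rev_word g n.+1 = g n :: rev_word g n.
Proof. by rewrite /rev_word -addn1 iotaD rev_cat. Qed.

Lemma size_rev_word g n : size (rev_word g n) = n.
Proof. by rewrite size_map size_rev size_iota. Qed.

Definition letter_fun n (pi : colperm N n) (i : nat) : letter :=
  if insub i is Some k then (val (pi.1 k), val (pi.2 k)) else (0%N, 0%N).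

Lemma letter_funE n (pi : colperm N n) (i : 'I_n) :
  letter_fun pi i = (val (pi.1 i), val (pi.2 i)).
Proof. by rewrite /letter_fun valK. Qed.

Definition colperm_word n (pi : colperm N n) := rev_word (letter_fun pi) n.

Lemma colperm_word_inj n : injective (@colperm_word n).
Proof.
move=> pi pi' /eq_in_map eq_w.
have E (i : 'I_n) : (val (pi.1 i), val (pi.2 i)) = (val (pi'.1 i), val (pi'.2 i)).
  by rewrite -!letter_funE eq_w // mem_rev mem_iota /=.
move: {eq_w} E; case: pi => [u c]; case: pi' => [u' c'] /= E; congr (_, _).
  by apply/permP => i; apply: val_inj; case: (E i).
by apply/ffunP => i; apply: val_inj; case: (E i).
Qed.

Lemma colperm_word_injw n (pi : colperm N n) : colperm_word pi \in injw N n n.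
Proof.
rewrite mem_injw size_rev_word eqxx /=; apply/andP; split.
  rewrite /unzip1 /colperm_word /rev_word -map_comp.
  rewrite map_inj_in_uniq ?rev_uniq ?iota_uniq // => i j.
  rewrite !mem_rev !mem_iota /= => i_n j_n.
  rewrite (letter_funE pi (Ordinal i_n)) (letter_funE pi (Ordinal j_n)) /=.
  by move=> /val_inj/perm_inj[].
apply/allP => x /mapP[i]; rewrite mem_rev mem_iota /= => i_n ->.
by rewrite (letter_funE pi (Ordinal i_n)) mem_letters !ltn_ord.
Qed.

Lemma size_injw T n : size (injw N T n) = (N ^ n * T ^_ n)%N.
Proof.
elim: n => // n IHn; rewrite size_allpairs_dep.
rewrite sumnE big_map big_seq (eq_bigr (fun=> N * (T - n))%N) => [|p pT].
  by rewrite -big_seq big_const_seq count_predT iter_addn_0 IHn ffactnSr expnSr; lia.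
rewrite size_filter -sum1_count big_mkcond big_allpairs_dep.
under eq_bigr => c _ do rewrite -big_mkcond sum1_count -/(predC _) (count_avoid pT).
by rewrite big_const_seq count_predT size_iota iter_addn_0 mulnC.
Qed.

(** [colperm_word] is injective into [injw N n n], and both sides have N^n n! elements. *)
Lemma sum_colperm (V : nmodType) n (G : seq letter -> V) :
  \sum_(pi : colperm N n) G (colperm_word pi) = \sum_(p <- injw N n n) G p.
Proof.
rewrite -big_enum -(big_map (@colperm_word n) predT G); apply: perm_big.
have U : uniq [seq colperm_word pi | pi <- enum {: colperm N n}].
  by rewrite map_inj_uniq ?enum_uniq //; apply: colperm_word_inj.
have sub : {subset [seq colperm_word pi | pi <- enum {: colperm N n}] <= injw N n n}.
  by move=> _ /mapP[pi _ ->]; apply: colperm_word_injw.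
have [|_ eq_mem] := uniq_min_size U sub.
  rewrite size_map -cardE size_injw card_prod card_Sn card_ffun !card_ord.
  by rewrite ffactnn mulnC.
exact: uniq_perm U (injw_uniq _ _ _) eq_mem.
Qed.

Lemma majw_word n (pi : colperm N n) : majw (colperm_word pi) = maj pi.
Proof.
case: n pi => [|n] pi; first by rewrite /maj big_ord0.
have -> g : majw (rev_word g n.+1) = (\sum_(i < n) ltl (g i.+1) (g i) * i.+1)%N.
  clear pi; elim: n => [|n IHn]; first by rewrite big_ord0.
  rewrite rev_wordS [majw _]/= IHn big_ord_recr /= size_rev_word.
  by rewrite rev_wordS.
rewrite /maj [RHS]big_mkcond [RHS]big_ord_recr /= [X in (_ + X)%N]ifN ?addn0; last first.
  rewrite inE; apply/existsP => -[j /andP[/eqP jn _]].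
  by have := ltn_ord j; rewrite jn ltnn.
apply: eq_bigr => i _; rewrite inE.
rewrite (letter_funE pi (lift ord0 i)) (letter_funE pi (widen_ord (leqnSn n) i)).
rewrite (_ : [exists _, _] = ltl (letter_at pi (lift ord0 i))
   (letter_at pi (widen_ord (leqnSn n) i))).
  by rewrite /ltl /= ltnS; case: (_ || _); rewrite ?mul1n ?mul0n.
apply/existsP/idP => [[j /andP[/eqP ji]]|].
  by rewrite (_ : j = lift ord0 i) //; apply: val_inj.
by exists (lift ord0 i); rewrite eqxx.
Qed.

End ColoredPermutationWords.

(** * Weights of words and the statistics exc, fix and col *)

Section Weight.
Variables (R : comUnitRingType) (N : nat) (t : R) (r s : nat -> R).

Lemma prod_pick (x : nat -> R) c : (c < N)%N ->
  \prod_(0 <= k < N) (if c == k then x k else 1) = x c.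
Proof.
move=> cN; rewrite big_mkord (bigD1 (Ordinal cN)) //= eqxx big1 ?mulr1 // => k.
by rewrite -val_eqE eq_sym /= => /negPf->.
Qed.

Lemma wtw_word n (pi : colperm N n) :
  wtw (wlt s) (weq r s) (wgt t s) (colperm_word pi) =
  t ^+ exc pi * (\prod_(0 <= k < N) r k ^+ fixk pi k)
    * (\prod_(1 <= m < N) s m ^+ colm pi m).
Proof.
have -> g k : wtw (wlt s) (weq r s) (wgt t s) (rev_word g k) =
    \prod_(i < k) wt (wlt s) (weq r s) (wgt t s) (g i) i.
  elim: k => [|k IHk]; first by rewrite big_ord0.
  by rewrite rev_wordS /= IHk big_ord_recr /= mulrC size_rev_word.
have card_prod (P : pred 'I_n) (x : R) :
    x ^+ #|[set i | P i]| = \prod_i (if P i then x else 1).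
  by rewrite -prodr_const big_mkcond; apply: eq_bigr => i _; rewrite inE.
under [X in _ * X * _]eq_bigr => k _ do rewrite card_prod.
under [X in _ * X]eq_bigr => k _ do rewrite card_prod.
(* All powers are now products over positions, so the identity can be checked at each position. *)
rewrite card_prod exchange_big [X in _ * X]exchange_big -!big_split /=.
apply: eq_bigr => i _; rewrite letter_funE.
set c := val (pi.2 i); have cN : (c < N)%N by apply: ltn_ord.
rewrite [X in _ * X](_ : _ = wlt s c); last first.
  rewrite -(prod_pick (wlt s) cN) [RHS]big_ltn ?(leq_ltn_trans _ cN) //.
  rewrite [X in _ = X * _](_ : _ = 1) ?mul1r; last by case: eqP.
  by apply: eq_big_nat => -[].
rewrite [X in _ * X * _](_ : _ = if pi.1 i == i then r c else 1); last first.
  rewrite -(prod_pick (fun k => if pi.1 i == i then r k else 1) cN).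
  apply: eq_bigr => k _; rewrite /letter_at xpair_eqE eqSS -/c val_eqE.
  by case: eqP; case: eqP.
rewrite /wt /ltl /= -/c ltnS -(val_eqE (pi.1 i)) /=.
rewrite /weq; case: ltngtP => _; case: (c) => [|k] //=; ring.
Qed.

End Weight.

(** * The theorem *)

Section GeneralRing.
Variables (R : comUnitRingType) (N : nat) (q t : R) (r s : nat -> R).

Definition colperm_gf : fps R := FPS (fun n => \sum_(pi : colperm N n)
  (qfac q n)^-1 * t ^+ exc pi * (\prod_(0 <= k < N) r k ^+ fixk pi k)
  * (\prod_(1 <= m < N) s m ^+ colm pi m) * q ^+ maj pi).

Definition gf_num : fps R :=
  dilate (r 0%N) (qexp q) * fpsC (1 - t * q)
  * \prod_(1 <= m < N) (dilate (- s m) (qExp q) * dilate (r m * s m) (qexp q)).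

Definition gf_den : fps R :=
  fpsC (1 + \sum_(1 <= m < N) s m) * dilate (t * q) (qexp q)
  - fpsC (t * q + \sum_(1 <= m < N) s m) * qexp q.

Lemma colperm_gfE : (0 < N)%N ->
    (forall n, (0 < n)%N -> qnum q n \is a GRing.unit) -> GRing.lreg (1 - q) ->
    1 - t * q \is a GRing.unit ->
  colperm_gf * gf_den = gf_num.
Proof.
move=> N_gt0 qU q1 tqU; rewrite /gf_num -wgf_closed_form //; congr (_ * (_ - _ * _)).
  apply/fpsP => n /=; rewrite addn0 -sum_colperm; apply: eq_bigr => pi _.
  rewrite /psi (_ : (if _ then 1 else _) = 1) ?mul1r; last by case: colperm_word.
  by rewrite /gw majw_word wtw_word size_rev_word; ring.
by apply/fpsP => n /=; rewrite expr1n mul1r.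
Qed.
End GeneralRing.

(** * Specialization of the coefficient ring *)

Section Morphism.
Variables (R S : comUnitRingType) (h : {rmorphism R -> S}).

Definition map_fps (f : fps R) : fps S := FPS (fun n => h (fcoef f n)).

Fact map_fps_is_additive : zmod_morphism map_fps.
Proof. by move=> f g; apply/fpsP => n; rewrite /= rmorphB. Qed.
Fact map_fps_is_multiplicative : monoid_morphism map_fps.
Proof.
split=> [|f g]; apply/fpsP => n; first by rewrite /=; case: eqP; rewrite ?rmorph1 ?rmorph0.
by rewrite /= rmorph_sum; apply: eq_bigr => i _; rewrite rmorphM.
Qed.
HB.instance Definition _ :=
  GRing.isZmodMorphism.Build (fps R) (fps S) map_fps map_fps_is_additive.
HB.instance Definition _ :=
  GRing.isMonoidMorphism.Build (fps R) (fps S) map_fps map_fps_is_multiplicative.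

Lemma map_fpsC c : map_fps (fpsC c) = fpsC (h c).
Proof. by apply/fpsP => n /=; case: eqP; rewrite ?rmorph0. Qed.

Lemma map_fps_dilate c f : map_fps (dilate c f) = dilate (h c) (map_fps f).
Proof. by apply/fpsP => n; rewrite /= rmorphM rmorphXn. Qed.

Variable q : R.
Hypothesis qnum_unit : forall n, (0 < n)%N -> qnum q n \is a GRing.unit.

Lemma rmorph_qnum n : h (qnum q n) = qnum (h q) n.
Proof. by rewrite rmorph_sum; apply: eq_bigr => i _; rewrite rmorphXn. Qed.

Lemma rmorph_qfacV n : h (qfac q n)^-1 = (qfac (h q) n)^-1.
Proof.
rewrite rmorphV ?qfac_unit // rmorph_prod; congr _^-1.
by apply: eq_bigr => i _; apply: rmorph_qnum.
Qed.

Lemma map_fps_qexp : map_fps (qexp q) = qexp (h q).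
Proof. by apply/fpsP => n; rewrite /= rmorph_qfacV. Qed.

Lemma map_fps_qExp : map_fps (qExp q) = qExp (h q).
Proof. by apply/fpsP => n; rewrite /= rmorphM rmorphXn rmorph_qfacV. Qed.

Lemma map_colperm_gfE N t r s :
    colperm_gf N q t r s * gf_den N q t s = gf_num N q t r s ->
  colperm_gf N (h q) (h t) (h \o r) (h \o s) * gf_den N (h q) (h t) (h \o s) =
  gf_num N (h q) (h t) (h \o r) (h \o s).
Proof.
have <- : map_fps (colperm_gf N q t r s) = colperm_gf N (h q) (h t) (h \o r) (h \o s).
  apply/fpsP => n; rewrite /= rmorph_sum; apply: eq_bigr => pi _.
  rewrite !rmorphM !rmorphXn rmorph_qfacV !rmorph_prod.
  by congr (_ * _ * _ * _); apply: eq_bigr => k _; rewrite rmorphXn.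
have <- : map_fps (gf_den N q t s) = gf_den N (h q) (h t) (h \o s).
  rewrite /gf_den rmorphB !rmorphM /= !map_fpsC map_fps_dilate map_fps_qexp.
  by rewrite !rmorphD !rmorphM rmorph1 !rmorph_sum.
have <- : map_fps (gf_num N q t r s) = gf_num N (h q) (h t) (h \o r) (h \o s).
  rewrite /gf_num !rmorphM rmorph_prod /= map_fpsC map_fps_dilate map_fps_qexp.
  rewrite rmorphB rmorph1 rmorphM; congr (_ * _); apply: eq_bigr => k _.
  by rewrite rmorphM /= !map_fps_dilate map_fps_qexp map_fps_qExp rmorphN rmorphM.
by rewrite -rmorphM => ->.
Qed.
End Morphism.

Section ConstantCoefficient.
Variable R : comUnitRingType.

Definition fps_coef0 (f : fps R) : R := fcoef f 0.

Fact fps_coef0_is_additive : zmod_morphism fps_coef0.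
Proof. by []. Qed.
Fact fps_coef0_is_multiplicative : monoid_morphism fps_coef0.
Proof. by split=> // f g; apply: fcoefM0. Qed.
HB.instance Definition _ :=
  GRing.isZmodMorphism.Build (fps R) R fps_coef0 fps_coef0_is_additive.
HB.instance Definition _ :=
  GRing.isMonoidMorphism.Build (fps R) R fps_coef0 fps_coef0_is_multiplicative.
End ConstantCoefficient.

(* For q = 1, where 1 - q^n vanishes, the identity is proved over F[[x]] for
   the parameter 1 + x, and then specialized to x = 0. *)
Lemma colperm_gf_field (F : fieldType) (N : nat) (q t : F) (r s : nat -> F) :
    (0 < N)%N -> (forall n, (0 < n)%N -> qnum q n != 0) -> 1 - t * q != 0 ->
  colperm_gf N q t r s * gf_den N q t s = gf_num N q t r s.
Proof.
move=> N_gt0 q_neq0 tq_neq1.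
have [q1|q_neq1] := eqVneq q 1; last first.
  apply: colperm_gfE => // [n n_gt0||]; rewrite ?unitfE ?q_neq0 //.
  by apply/lregP; rewrite subr_eq0 eq_sym.
pose h : {rmorphism fps F -> F} := @fps_coef0 F; pose q' : fps F := 1 + fpsX.
have hq' : h q' = q by rewrite q1 /h /fps_coef0 /= addr0.
have q'U n : (0 < n)%N -> qnum q' n \is a GRing.unit.
  by move=> n_gt0; rewrite fps_unitE -[fcoef _ _]/(h _) rmorph_qnum hq' unitfE q_neq0.
have := map_colperm_gfE h q'U
  (colperm_gfE (t := fpsC t) (@fpsC F \o r) (@fpsC F \o s) N_gt0 q'U _ _).
rewrite hq'; apply.
  (* 1 - (1 + x) = - x, and multiplication by x only shifts the coefficients. *)
  move=> f g; rewrite /q' opprD addNKr !mulNr => /oppr_inj/fpsP fg.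
  by apply/fpsP => n; have := fg n.+1; rewrite !fcoefXM.
rewrite fps_unitE -[fcoef _ _]/(h _) rmorphB rmorph1 rmorphM hq' unitfE.
exact: tq_neq1.
Qed.

Theorem theorem1p4 (F : fieldType) (N : nat) (q t : F) (r s : nat -> F)
    (N_gt0 : (0 < N)%N)
    (qint_neq0 : forall n : nat, (0 < n)%N -> qint q n != 0)
    (tq_neq1 : 1 - t * q != 0) :
  FPS (fun n : nat => \sum_(pi : colperm N n)
         (qfact q n)^-1 * t ^+ exc pi
         * (\prod_(0 <= k < N) r k ^+ fixk pi k)
         * (\prod_(1 <= m < N) s m ^+ colm pi m)
         * q ^+ maj pi)
  = (dilate (r 0%N) (expq q) * fpsC (1 - t * q)
     * \prod_(1 <= m < N)
         (dilate (- s m) (Expq q) * dilate (r m * s m) (expq q)))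
    / (fpsC (1 + \sum_(1 <= m < N) s m) * dilate (t * q) (expq q)
       - fpsC (t * q + \sum_(1 <= m < N) s m) * expq q).
Proof.
apply: (canRL (mulrK _)); last exact: colperm_gf_field.
(* The denominator has the constant coefficient [1 - t * q]. *)
rewrite fps_unitE fcoefD fcoefN !fcoefM0 /= [qfact q 0](qfac0 q) invr1 !mulr1.
by rewrite opprD addrACA subrr addr0 unitfE.
Qed.
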